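(* There is a function $f(n)=o(n^2)$ such that for every generic set $Y$ of $n$ points in $\mathbb{R}^3$ the box graph $G_b(Y)$ has at most $\frac{7}{16}n^2+f(n)$ edges. Up to the error term this bound is best possible: there is a function $g(n)=o(n^2)$ such that for every $n$ there is a generic set $Y$ of $n$ points in $\mathbb{R}^3$ whose box graph has at least $\frac{7}{16}n^2-g(n)$ edges.
   Context: A box is a closed axis-aligned box in $\mathbb{R}^3$. A finite set $Y\subset\mathbb{R}^3$ is generic if no two of its points share a coordinate. For $p,q\in Y$, $B[p,q]$ is the smallest box containing $p$ and $q$. The box graph $G_b(Y)$ has vertex set $Y$, and $p,q$ are adjacent iff the open interior of $B[p,q]$ contains no point of $Y$. *)

(* Defs.v *)
From mathcomp Require Export all_boot all_order all_algebra.
From mathcomp Require Export finmap.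
From mathcomp Require Export all_classical all_reals all_analysis.

Set Implicit Arguments.
Unset Strict Implicit.
Unset Printing Implicit Defensive.

Import Order.TTheory GRing.Theory Num.Theory.
Import numFieldNormedType.Exports.

Local Open Scope classical_set_scope.
Local Open Scope ring_scope.

Definition box (R : realType) (a b : 'rV[R]_3) : set 'rV[R]_3 :=
  [set x | forall i, a ord0 i <= x ord0 i <= b ord0 i].

Definition is_box (R : realType) : set (set 'rV[R]_3) :=
  [set B | exists a b : 'rV[R]_3,
     (forall i, a ord0 i <= b ord0 i) /\ B = box a b].

(* [smallest] is the intersection of all boxes containing p and q; by [bboxE]
   it is itself a box. *)
Definition bbox (R : realType) (p q : 'rV[R]_3) : set 'rV[R]_3 :=
  smallest (@is_box R) [set p; q].

Definition generic (R : realType) (Y : {fset 'rV[R]_3}) : Prop :=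
  forall p q : 'rV[R]_3, p \in Y -> q \in Y -> p != q ->
  forall i, p ord0 i != q ord0 i.

(* The interior is taken in the product topology of 'rV[R]_3. *)
Definition box_graph (R : realType) (Y : {fset 'rV[R]_3}) : rel Y :=
  fun p q => (p != q) &&
    `[< ~ exists z : Y, interior (bbox (val p) (val q)) (val z) >].

Arguments box_graph {R} Y.

(* For a symmetric irreflexive relation; edges are unordered pairs. *)
Definition edges (T : finType) (e : rel T) : {set {set T}} :=
  [set [set pq.1; pq.2]%SET | pq : T * T & e pq.1 pq.2]%SET.

Lemma bboxE (R : realType) (p q : 'rV[R]_3) :
  bbox p q = box (\row_i Num.min (p ord0 i) (q ord0 i))
                 (\row_i Num.max (p ord0 i) (q ord0 i)).
Proof.
apply/seteqP; split => x.
- apply; split=> [|y].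
  + exists (\row_i Num.min (p ord0 i) (q ord0 i)),
           (\row_i Num.max (p ord0 i) (q ord0 i)); split=> // i.
    by rewrite !mxE ge_min le_max lexx.
  + by move=> [->|->] i; rewrite !mxE ge_min le_max lexx ?orbT.
- move=> xpq B [[a [b [_ ->]]] pqB] i.
  have /(_ i) /andP[ap pb] := pqB p (or_introl erefl).
  have /(_ i) /andP[aq qb] := pqB q (or_intror erefl).
  have := xpq i; rewrite !mxE => /andP[h1 h2]; apply/andP; split.
  + by apply: le_trans h1; rewrite le_min ap.
  + by apply: le_trans h2 _; rewrite ge_max pb.
Qed.

(* Main.v *)
Require Import Defs.
From mathcomp Require Import all_boot all_order all_algebra.
From mathcomp Require Import finmap all_classical all_reals all_analysis.
From mathcomp Require Import zify lra.

(* Upper bound.  Orienting every pair of points by its first coordinate, the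
   signs in the other two coordinates give four partial orders ("colours") such
   that any two points are comparable in exactly one of them, and p, q are
   adjacent iff one covers the other in their order.  By Erdos-Szekeres all but
   L^4 points can be split into chains of size at least L.  A point q covers at
   most one member of a chain, and is covered by at most one, so deleting the
   edges at each chain in the colour of that chain costs O(n^2 / L) edges.
   Afterwards each remaining point p lacks edges of one colour.  In a clique K
   of the remaining graph, the colours in which p has a member of K below it
   form a 0/1 vector with one free entry, and these vectors are pairwise
   incompatible: each p occupies an edge of the cube {0,1}^4, so |K| <= 8 and
   Turan's theorem gives 7/16 n^2.

   Lower bound.  Take eight clusters of n/8 points, each increasing in all
   coordinates, placed so that no two clusters differ by an all-positive vector
   and no cluster is inside the box of two others; then any two points of
   different clusters are adjacent. *)

Import Order.TTheory GRing.Theory Num.Theory.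
Import numFieldNormedType.Exports.

Set Implicit Arguments.
Unset Strict Implicit.
Unset Printing Implicit Defensive.

(** * Turan's theorem, counted in ordered pairs *)

Section Turan.
Import mathcomp.boot.fintype mathcomp.boot.finset.
Local Open Scope nat_scope.
Variables (T : finType) (e : rel T).

Definition arcs (S : {set T}) := \sum_(p in S) \sum_(q in S) e p q.

Lemma arcsT : arcs [set: T] = \sum_p \sum_q e p q.
Proof.
by apply: eq_big => [p|p _]; rewrite ?inE //; apply: eq_bigl => q; rewrite inE.
Qed.

Definition clique (K : {set T}) := {in K &, forall p q, p != q -> e p q}.

Hypotheses (e_sym : symmetric e) (e_irr : irreflexive e).

(** Induction on [r] through the neighbourhood [N] of a vertex of maximal degree: cliques in [N]
    have at most [r - 1] points, and the arcs not inside [N] are paid for by the points of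
    [S :\: N], each of degree at most [#|N|]. *)
Lemma turan_arcs (r : nat) (S : {set T}) :
  (forall K : {set T}, K \subset S -> clique K -> #|K| <= r) ->
  r * arcs S <= r.-1 * #|S| ^ 2.
Proof.
elim: r S => [|r IHr] S cliqueS; first by rewrite !mul0n.
have [->|[v0 v0S]] := set_0Vmem S; first by rewrite /arcs big_set0 muln0.
pose deg p := \sum_(q in S) e p q.
have [v vS vmax] : exists2 v, v \in S & forall p, p \in S -> deg p <= deg v.
  by case: (arg_maxnP deg v0S) => v vS vmax; exists v.
pose N := [set q in S | e v q].
have degN : deg v = #|N|.
  rewrite /deg -big_mkcondr sum1dep_card /=.
  by apply: eq_card => q; rewrite !inE.
have NS : N \subset S by apply/subsetP => q; rewrite inE => /andP[].
have vN : v \notin N by rewrite inE e_irr andbF.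
have cliqueN (K : {set T}) : K \subset N -> clique K -> #|K| <= r.
  move=> KN Kc.
  have vK : v \notin K by apply: contra vN; apply: (subsetP KN).
  have : #|v |: K| <= r.+1.
    apply: cliqueS => [|p q].
      by rewrite subUset sub1set vS (subset_trans KN).
    have eK x : x \in K -> e v x by move=> /(subsetP KN); rewrite inE => /andP[].
    rewrite !inE => /orP[/eqP->|pK] /orP[/eqP->|qK] pq; rewrite ?eqxx in pq => //.
    - exact: eK.
    - by rewrite e_sym eK.
    - exact: Kc.
  by rewrite cardsU1 vK.
have {IHr} := IHr _ cliqueN.
have splitS (F : T -> nat) :
    \sum_(p in S) F p = \sum_(p in N) F p + \sum_(p in S :\: N) F p.
  rewrite (big_setID N) /=; congr (_ + _); apply: eq_bigl => p.
  by rewrite (setIidPr NS).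
have cardS : #|S| = #|N| + #|S :\: N| by rewrite -(cardsID N) (setIidPr NS).
have outer : \sum_(p in S :\: N) deg p <= #|S :\: N| * #|N|.
  rewrite -sum_nat_const; apply: leq_sum => p; rewrite inE => /andP[_ pS].
  by rewrite -degN vmax.
have arcsS : arcs S <= arcs N + 2 * (#|S :\: N| * #|N|).
  rewrite /arcs splitS -/(deg _) mul2n -addnn addnA leq_add //.
  rewrite (eq_bigr (fun p => \sum_(q in N) e p q + \sum_(q in S :\: N) e p q));
    last by move=> p _; rewrite splitS.
  rewrite big_split leq_add2l exchange_big /=; apply: leq_trans outer.
  apply: leq_sum => q _; rewrite /deg splitS.
  by under eq_bigr do rewrite e_sym; rewrite leq_addr.
(* For [r = 0] the induction hypothesis says nothing about [arcs N]; but a one-point set is a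
   clique, so [N] is empty. *)
case: r {cliqueS} cliqueN => [|r] cliqueN IH.
  have N0 : N = set0.
    apply/eqP; rewrite -subset0; apply/subsetP => u uN.
    have := cliqueN [set u]; rewrite cards1 => /(_ _ _) K1; rewrite inE; apply: K1.
      by rewrite sub1set.
    by move=> p q; rewrite !inE => /eqP-> /eqP->; rewrite eqxx.
  by move: arcsS; rewrite N0 /arcs big_set0 cards0 muln0 mul1n.
move: arcsS IH; rewrite /= cardS.
move: (arcs S) (arcs N) #|N| #|S :\: N| => x y d m.
rewrite -!mulnn => H1 H2.
(* With the factor [r.+1], substituting both bounds leaves the square of [d - r.+1 * m], nonnegative
   by [amgm]. *)
suff : r.+1 * (r.+2 * x) <= r.+1 * (r.+1 * ((d + m) * (d + m))).
  by rewrite leq_mul2l.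
have amgm := (nat_Cauchy d (r.+1 * m)).1.
have {}H1 : r.+2 * (r.+1 * x) <= r.+2 * (r.+1 * (y + 2 * (m * d))).
  by rewrite !leq_mul2l H1 !orbT.
have {}H2 : r.+2 * (r.+1 * y) <= r.+2 * (r * (d * d)) by rewrite leq_mul2l H2 orbT.
rewrite -!mulnn in amgm.
nia.
Qed.
End Turan.

(** * Unions of Hasse diagrams of partial orders *)

Section HasseUnion.
Import mathcomp.boot.fintype mathcomp.boot.finset.
Local Open Scope nat_scope.
Variables (T C : finType) (r : C -> rel T) (e : rel T).
Hypotheses (r_irr : forall c, irreflexive (r c))
           (r_trans : forall c, transitive (r c))
           (r_total : forall p q, p != q -> exists c, r c p q || r c q p)
           (e_sym : symmetric e) (e_irr : irreflexive e)
           (e_hasse : forall c p q z, r c p z -> r c z q -> ~~ e p q).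

Definition chain (c : C) (B : {set T}) :=
  [forall p in B, forall q in B, (p != q) ==> r c p q || r c q p].

Lemma chainP c (B : {set T}) :
  reflect {in B &, forall p q, p != q -> r c p q || r c q p} (chain c B).
Proof.
apply: (iffP forall_inP) => [Bc p q pB qB pq|Bc p pB].
  by have /forall_inP/(_ _ qB)/implyP := Bc _ pB; apply.
by apply/forall_inP => q qB; apply/implyP; apply: Bc.
Qed.

Definition height (A : {set T}) c p :=
  \max_(B : {set T} | [&& B \subset A, chain c B & [forall x in B, r c x p]]) #|B|.

Lemma height_attained (A : {set T}) c p : p \in A ->
  exists B : {set T}, [/\ B \subset A, chain c B, p \in B,
    forall q, q \in B -> q != p -> r c q p & #|B| = (height A c p).+1].
Proof.
move=> pA; pose P (B : {set T}) :=
  [&& B \subset A, chain c B & [forall x in B, r c x p]].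
have P0 : P set0.
  rewrite /P sub0set /=; apply/andP; split.
    by apply/chainP => x y; rewrite inE.
  by apply/forall_inP => x; rewrite inE.
have /(eq_bigmax_cond (fun B : {set T} => #|B|)) : 0 < #|P|.
  by apply/card_gt0P; exists set0.
case=> B /and3P[BA /chainP Bc /forall_inP Bp] cardB; exists (p |: B); split.
- by rewrite subUset sub1set pA.
- apply/chainP => x y; rewrite !inE.
  move=> /orP[/eqP->|xB] /orP[/eqP->|yB] xy; first by rewrite eqxx in xy.
  + by rewrite Bp ?orbT.
  + by rewrite Bp.
  + exact: Bc.
- by rewrite !inE eqxx.
- by move=> q; rewrite !inE => /orP[->//|qB _]; apply: Bp.
- rewrite cardsU1 /height cardB.
  by have /negPf-> : p \notin B by apply/negP => /Bp; rewrite r_irr.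
Qed.

Lemma height_lt (A : {set T}) c p q : p \in A -> r c p q -> height A c p < height A c q.
Proof.
move=> pA pq; have [B [BA Bc pB Bp cardB]] := height_attained c pA.
rewrite -cardB; apply: (leq_bigmax_cond (F := fun B : {set T} => #|B|)).
rewrite BA Bc; apply/forall_inP => x xB.
by have [->//|xp] := eqVneq x p; apply: r_trans pq; apply: Bp.
Qed.

(** Erdos-Szekeres by pigeonhole: without such a chain all heights are below [L], and two points
    comparable in colour [c] differ in their height for [c], so the height vectors are distinct. *)
Lemma monotone_chain (L : nat) (A : {set T}) : 0 < L -> L ^ #|C| < #|A| ->
  exists c (B : {set T}), [/\ B \subset A, chain c B & L <= #|B|].
Proof.
case: L => // L _ cardA.
suff : [exists c, [exists B : {set T}, [&& B \subset A, chain c B & L.+1 <= #|B|]]].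
  by move=> /existsP[c /existsP[B /and3P[? ? ?]]]; exists c, B.
apply: contraLR cardA => noChain; rewrite -leqNgt.
have short c p : p \in A -> height A c p < L.+1.
  move=> pA; have [B [BA Bc _ _ <-]] := height_attained c pA.
  have /existsPn/(_ c)/existsPn/(_ B) := noChain.
  by rewrite BA Bc /= -ltnNge; apply: ltnW.
pose h p := [ffun c => inord (height A c p) : 'I_L.+1].
have h_inj : {in A &, injective h}.
  move=> p q pA qA /ffunP hpq; apply/eqP/negPn/negP => pq.
  have [c pqc] := r_total pq.
  have hE : height A c p = height A c q.
    by have := congr1 val (hpq c); rewrite !ffunE /= !inordK ?short.
  by case/orP: pqc => /(height_lt (A := A)); rewrite hE ltnn;
    [move=> /(_ pA)|move=> /(_ qA)].
rewrite -(card_in_imset h_inj) -[L.+1 in leqRHS]card_ord -card_ffun.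
exact: max_card.
Qed.

Definition colour_nbrs c p := #|[set q | e p q && (r c p q || r c q p)]|.

(** Double counting over the other endpoint [q]: it has at most one neighbour in [B] on each side,
    since of two the nearer lies between [q] and the farther. *)
Lemma chain_colour_nbrs c (B : {set T}) : chain c B ->
  \sum_(p in B) colour_nbrs c p <= 2 * #|T|.
Proof.
move=> /chainP Bc.
have uniq_below q : #|[set p in B | e p q && r c p q]| <= 1.
  apply/card_le1_eqP => x y; rewrite !inE => /and3P[xB exq xq] /and3P[yB eyq yq].
  apply/eqP/negPn/negP => /(Bc _ _ yB xB)/orP[] H.
    by move: eyq; apply/negP/(e_hasse H).
  by move: exq; apply/negP/(e_hasse H).
have uniq_above q : #|[set p in B | e p q && r c q p]| <= 1.
  apply/card_le1_eqP => x y; rewrite !inE => /and3P[xB exq xq] /and3P[yB eyq yq].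
  apply/eqP/negPn/negP => /(Bc _ _ yB xB)/orP[] H.
    by move: exq; rewrite e_sym; apply/negP/(e_hasse yq).
  by move: eyq; rewrite e_sym; apply/negP/(e_hasse xq).
have -> : \sum_(p in B) colour_nbrs c p =
          \sum_q #|[set p in B | e p q && (r c p q || r c q p)]|.
  under eq_bigr do rewrite /colour_nbrs -sum1dep_card big_mkcond /=.
  rewrite exchange_big /=; apply: eq_bigr => q _.
  by rewrite -sum1dep_card [RHS]big_mkcondr.
rewrite -sum1_card mulnC big_distrl /=; apply: leq_sum => q _.
apply: leq_trans (leq_add (uniq_below q) (uniq_above q)).
apply: leq_trans (leq_card_setU _ _).
apply/subset_leq_card/subsetP => p; rewrite !inE.
by case: (p \in B); case: (e p q).
Qed.

(** Chains are extracted greedily, each giving its colour to its points. A chain costs [2 * #|T|],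
    which is charged to its at least [L] points. *)
Lemma chain_decomposition (c0 : C) (L : nat) (A : {set T}) : 0 < L ->
  exists (A0 : {set T}) (col : T -> C), [/\ A0 \subset A, #|A0| <= L ^ #|C| &
    L * (\sum_(p in A :\: A0) colour_nbrs (col p) p) <= 2 * #|T| * #|A|].
Proof.
move=> L_gt0; have [n] := ubnP #|A|; elim: n A => // n IHn A.
rewrite ltnS => cardA.
have [small|/(monotone_chain L_gt0)[c [B [BA Bc cardB]]]] := leqP #|A| (L ^ #|C|).
  exists A, (fun=> c0); split=> //.
  by rewrite setDv big_set0 muln0.
have cardAB : #|A| = #|B| + #|A :\: B| by rewrite -(cardsID B) (setIidPr BA).
have [|A0 [col [A0AB cardA0 sum_col]]] := IHn (A :\: B).
  by clear -cardA cardAB cardB L_gt0; lia.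
exists A0, (fun p => if p \in B then c else col p); split=> //.
  by apply: subset_trans A0AB (subsetDl _ _).
have disj p : p \in B -> p \notin A0.
  by move=> pB; apply/negP => /(subsetP A0AB); rewrite inE pB.
rewrite (big_setID B) mulnDr cardAB mulnDr leq_add //=.
  apply: leq_trans (_ : L * (2 * #|T|) <= _); last by rewrite mulnC leq_mul.
  rewrite leq_mul2l; apply/orP; right; apply: leq_trans (chain_colour_nbrs Bc).
  rewrite (_ : (A :\: A0) :&: B = B).
    by rewrite leq_eqVlt; apply/orP; left; apply/eqP; apply: eq_bigr => p ->.
  apply/setIidPr/subsetP => p pB; rewrite inE disj //; exact: (subsetP BA).
apply: leq_trans sum_col; rewrite leq_mul2l setDDl setUC -setDDl.
rewrite leq_eqVlt; apply/orP; right; apply/orP; left; apply/eqP; apply: eq_bigr => p.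
by rewrite !inE => /and3P[_ /negPf->].
Qed.

(* Label a member [p] of the clique [K] by the colours in which some member of
   [K] lies below it; since [p] has no clique edge of colour [col p], the
   entry [col p] is free, so [p] occupies an edge of the cube {0,1}^C. *)
Lemma card_clique_star (col : T -> C) (K : {set T}) :
  {in K &, forall p q, p != q ->
     [&& e p q, ~~ r (col p) p q & ~~ r (col p) q p]} ->
  #|K| <= (2 ^ #|C|)./2.
Proof.
move=> Kc.
pose lbl (pb : T * bool) := [ffun c =>
  if c == col pb.1 then pb.2 else [exists q in K, r c q pb.1]].
(* Bit [c] is set at [q], witnessed by [p], and unset at [p]: a member [x] below [p] would have [p]
   between it and [q], so [x] and [q] would not be adjacent. *)
have bit_lt c p q : p \in K -> q \in K -> r c p q -> forall b b',
    lbl (p, b) c != lbl (q, b') c.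
  move=> pK qK pq b b'; rewrite !ffunE /=.
  have pNq : p != q by apply: contraTneq pq => ->; rewrite r_irr.
  have /and3P[epq Npq _] := Kc _ _ pK qK pNq.
  have /and3P[_ _ Nqp] := Kc _ _ qK pK (contra_neq (@esym _ _ _) pNq).
  have [cp|_] := eqVneq c (col p); first by rewrite -cp pq in Npq.
  have [cq|_] := eqVneq c (col q); first by rewrite -cq pq in Nqp.
  have -> : [exists x in K, r c x q] by apply/exists_inP; exists p.
  rewrite eqb_id; apply/exists_inP => -[x xK xp].
  have xNq : x != q.
    by apply: contraTneq (r_trans xp pq) => ->; rewrite r_irr.
  by have /and3P[/negP] := Kc _ _ xK qK xNq; move=> []; apply/negPn/(e_hasse xp).
have lbl_inj : {in setX K [set: bool] &, injective lbl}.
  move=> [p b] [q b']; rewrite !inE !andbT /= => pK qK E.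
  have pq : p = q.
    apply/eqP/negPn/negP => /r_total[c /orP[]] H.
      by have := bit_lt _ _ _ pK qK H b b'; rewrite E eqxx.
    by have := bit_lt _ _ _ qK pK H b' b; rewrite E eqxx.
  by move: E; rewrite pq => /ffunP/(_ (col q)); rewrite !ffunE /= eqxx => ->.
have := max_card (mem (lbl @: setX K [set: bool])).
rewrite (card_in_imset lbl_inj) cardsX cardsT card_bool card_ffun card_bool => le2.
by rewrite -[leqLHS](half_bit_double _ false) half_leq //= add0n -muln2.
Qed.

(** Turan's theorem applies to the arcs that remain after two deletions: those meeting [A0], giving
    the term in [L ^ #|C|.+1], and those in the colour of an endpoint, giving [4 * #|T| ^ 2]. *)
Lemma hasse_union_arcs (c0 : C) (L : nat) : 0 < L ->
  (2 ^ #|C|)./2 * (L * arcs e [set: T]) <=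
  (2 ^ #|C|)./2.-1 * (L * #|T| ^ 2) +
  (2 ^ #|C|)./2 * (2 * L ^ #|C|.+1 * #|T| + 4 * #|T| ^ 2).
Proof.
move=> L_gt0; set m := (2 ^ #|C|)./2.
have [A0 [col [_ cardA0 sum_col]]] := chain_decomposition c0 [set: T] L_gt0.
rewrite setTD cardsT in sum_col.
pose bad p q := e p q && (r (col p) p q || r (col p) q p).
pose e' p q := [&& e p q, ~~ bad p q & ~~ bad q p].
have e'_sym : symmetric e'.
  by move=> p q; rewrite /e' e_sym; congr andb; rewrite andbC.
have e'_irr : irreflexive e' by move=> p; rewrite /e' e_irr.
have turan : m * arcs e' (~: A0) <= m.-1 * #|~: A0| ^ 2.
  apply: turan_arcs => // K _ Kc; apply: (card_clique_star (col := col)).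
  move=> p q pK qK pq; have /and3P[epq] := Kc _ _ pK qK pq.
  by rewrite /bad epq /= negb_or.
have sum_bad : \sum_p \sum_q ((p \notin A0) && bad p q) =
               \sum_(p in ~: A0) colour_nbrs (col p) p.
  rewrite [RHS]big_mkcond; apply: eq_bigr => p _.
  rewrite inE /colour_nbrs; case: (p \in A0) => /=; first by rewrite big1_eq.
  by rewrite -big_mkcond sum1dep_card.
have sum_A0 : \sum_p \sum_(q : T) (p \in A0) = #|A0| * #|T|.
  rewrite -sum_nat_const [RHS]big_mkcond /=; apply: eq_bigr => p _.
  by rewrite sum_nat_const cardT -cardE; case: (p \in A0); rewrite ?muln1 ?muln0.
have split_e p q : e p q <= ((p \in ~: A0) && (q \in ~: A0) && e' p q) +
    ((p \in A0) + (q \in A0)) +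
    ((p \notin A0) && bad p q + (q \notin A0) && bad q p).
  rewrite !inE /e'.
  by case: (p \in A0) (q \in A0) (bad p q) (bad q p) (e p q) => [] [] [] [] [].
have arcs_e' : \sum_p \sum_q ((p \in ~: A0) && (q \in ~: A0) && e' p q) =
               arcs e' (~: A0).
  rewrite /arcs [RHS]big_mkcond; apply: eq_bigr => p _.
  rewrite [in RHS]big_mkcond; case: (p \in ~: A0) => /=; last by rewrite big1_eq.
  by apply: eq_bigr => q _; case: (q \in ~: A0).
have arcs_e : arcs e [set: T] <= arcs e' (~: A0) + 2 * (#|A0| * #|T|) +
    2 * \sum_(p in ~: A0) colour_nbrs (col p) p.
  rewrite arcsT -arcs_e' !mul2n -!addnn -sum_bad -sum_A0.
  rewrite [X in _ + (_ + X) + _]exchange_big [X in _ + (_ + X)]exchange_big /=.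
  rewrite -!big_split /=; apply: leq_sum => p _.
  by rewrite -!big_split /=; apply: leq_sum => q _; apply: split_e.
have cardA0C : #|~: A0| <= #|T| by apply: max_card.
move: arcs_e turan sum_col cardA0 cardA0C.
move: (arcs e _) (arcs e' _) (bigop _ _ _) #|~: A0| #|A0| #|T| => x y s n' a n.
rewrite (expnS L #|C|); move: (L ^ _) m => b m xys ym Ls ab nn'.
have n2 : n' ^ 2 <= n ^ 2 by rewrite leq_sqr.
have H1 : m.-1 * (L * n' ^ 2) <= m.-1 * (L * n ^ 2) by rewrite !leq_mul2l n2 !orbT.
have H2 : L * (m * y) <= L * (m.-1 * n' ^ 2) by rewrite leq_mul2l ym orbT.
have H3 : m * (L * x) <= m * (L * (y + 2 * (a * n) + 2 * s)).
  by rewrite !leq_mul2l xys !orbT.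
have H4 : m * (L * s) <= m * (2 * n * n) by rewrite leq_mul2l Ls orbT.
have H5 : m * (L * (a * n)) <= m * (L * (b * n)).
  by rewrite !leq_mul2l leq_mul2r ab !orbT.
apply: leq_trans H3 _; rewrite -!mulnn in H1 H2 *.
move: m.-1 H1 H2 => k H1 H2; clear -H1 H2 H4 H5.
nia.
Qed.
End HasseUnion.

(** * Each edge is two ordered pairs *)

Section CardEdges.
Import mathcomp.boot.fintype mathcomp.boot.finset.

Lemma card_edges (T : finType) (e : rel T) : symmetric e -> irreflexive e ->
  (2 * #|edges e|)%N = arcs e [set: T].
Proof.
move=> e_sym e_irr.
have -> : arcs e [set: T] = (\sum_(pq in [set pq : T * T | e pq.1 pq.2]%SET) 1)%N.
  rewrite big_mkcond /=; under [RHS]eq_bigr => pq _ do rewrite inE.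
  rewrite -(pair_big xpredT xpredT (fun p q => if e p q then 1 else 0)%N) /=.
  by rewrite arcsT; apply: eq_bigr => p _; apply: eq_bigr => q _; case: (e p q).
rewrite mulnC -sum_nat_const.
rewrite (partition_big_imset (fun pq : T * T => [set pq.1; pq.2]%SET)) /=.
apply: eq_bigr => E /imsetP[[p q]]; rewrite inE /= => epq ->.
have pq : p != q by apply: contraTneq epq => ->; rewrite e_irr.
rewrite sum1_card -[LHS](_ : #|[set (p, q); (q, p)]%SET| = 2)%N; last first.
  by rewrite cards2 xpair_eqE (negPf pq).
apply: eq_card => -[x y]; rewrite [RHS]unfold_in /= !inE !xpair_eqE /=.
apply/orP/andP => [[]/andP[/eqP-> /eqP->]|[exy /eqP E2]].
- by rewrite epq eqxx.
- by rewrite e_sym epq; split=> //; apply/eqP; rewrite finset.setUC.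
have xy : x != y by apply: contraTneq exy => ->; rewrite e_irr.
have : x \in [set p; q]%SET by rewrite -E2 !inE eqxx.
have : y \in [set p; q]%SET by rewrite -E2 !inE eqxx orbT.
rewrite !inE => /orP[] /eqP Ey /orP[] /eqP Ex; move: xy; rewrite Ex Ey ?eqxx //.
- by right.
- by left.
Qed.

End CardEdges.

Local Open Scope fset_scope.
Local Open Scope classical_set_scope.
Local Open Scope ring_scope.

(** * Adjacency in terms of coordinates *)

Definition between (R : numDomainType) (a z b : R) := (a < z < b) || (b < z < a).

Lemma interior_box (R : realType) (a b x : 'rV[R]_3) :
  interior (box a b) x <-> forall i, a ord0 i < x ord0 i < b ord0 i.
Proof.
split=> [/nbhs_ballP[e /= e0 xe] i|axb].
  have e2 : 0 < e / 2 by rewrite divr_gt0.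
  (* Diagonal shifts by half the radius stay in the box, which makes both inequalities at [x]
     strict. *)
  have shift (t : R) : `|t| = e / 2 -> box a b (x + const_mx t).
    move=> te; apply: xe; split=> // j k.
    rewrite -ball_normE /= mxE opprD addNKr mxE normrN te.
    by rewrite ltr_pdivrMr // ltr_pMr // ltrDl.
  have := shift (e / 2) (gtr0_norm e2); have := shift (- (e / 2)).
  rewrite normrN gtr0_norm // => /(_ erefl)/(_ i)/andP[+ _] /(_ i)/andP[_].
  rewrite !mxE => h1 h2; apply/andP; split.
    by apply: le_lt_trans h1 _; rewrite gtrDl oppr_lt0.
  by apply: lt_le_trans h2; rewrite ltrDl.
have : nbhs x (fun y : 'rV[R]_3 => forall i, a ord0 i <= y ord0 i <= b ord0 i);
  last by [].
apply: (@filter_forall _ _ (fun i (y : 'rV[R]_3) => a ord0 i <= y ord0 i <= b ord0 i)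
  _ (nbhs_filter x)) => i.
have /andP[axi xbi] := axb i.
have cx : (fun y : 'rV[R]_3 => y ord0 i) @ x --> x ord0 i by apply: coord_continuous.
near=> y; apply/andP; split; apply: ltW; near: y.
  exact: (cx _ (lt_nbhsr axi)).
exact: (cx _ (lt_nbhsl xbi)).
Unshelve. all: by end_near. Qed.

Lemma box_graphE (R : realType) (Y : {fset 'rV[R]_3}) (p q : Y) :
  box_graph Y p q = (p != q) &&
    ~~ [exists z : Y, [forall i, between (val p ord0 i) (val z ord0 i) (val q ord0 i)]].
Proof.
have minmax (a b z : R) : (Num.min a b < z < Num.max a b) = between a z b.
  by rewrite gt_min lt_max /between; case: (ltgtP a z) => _; case: (ltgtP b z) => _.
rewrite /box_graph; congr andb; apply/asboolP/idP => [H|/existsPn H].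
  apply/existsPn => z; apply/negP => /forallP pzq; apply: H; exists z.
  by rewrite bboxE; apply/interior_box => i; rewrite !mxE minmax.
case=> z; rewrite bboxE => /interior_box pzq.
have /negP[] := H z; apply/forallP => i.
by have := pzq i; rewrite !mxE minmax.
Qed.

Lemma box_graph_sym (R : realType) (Y : {fset 'rV[R]_3}) : symmetric (@box_graph R Y).
Proof.
by move=> p q; rewrite /box_graph /bbox eq_sym setUC.
Qed.

Lemma box_graph_irr (R : realType) (Y : {fset 'rV[R]_3}) : irreflexive (@box_graph R Y).
Proof. by move=> p; rewrite /box_graph eqxx. Qed.

(** * The upper bound for a fixed chain length *)

Definition dir (R : numDomainType) (s : bool) (x y : R) := if s then x < y else y < x.

(* Of [q - p] and [p - q], the one with positive first coordinate has sign
   pattern [c] in the remaining coordinates. *)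
Definition orthant_lt (R : realType) (Y : {fset 'rV[R]_3})
    (c : {ffun 'I_2 -> bool}) : rel Y := fun p q =>
  (val p ord0 ord0 < val q ord0 ord0) &&
  [forall i, dir (c i) (val p ord0 (lift ord0 i)) (val q ord0 (lift ord0 i))].

(** Four colours give the clique bound [2 ^ 4 / 2 = 8]; counting edges instead of arcs turns the
    factor 8 into 16. *)
Lemma edges_box_graph_le (R : realType) (Y : {fset 'rV[R]_3}) (L : nat) :
  generic Y -> (0 < L)%N ->
  (16 * (L * #|edges (box_graph Y)|) <=
   7 * (L * #|` Y| ^ 2) + 8 * (2 * L ^ 5 * #|` Y| + 4 * #|` Y| ^ 2))%N.
Proof.
move=> Ygen L_gt0.
have cardC : #|{ffun 'I_2 -> bool}| = 4%N by rewrite card_ffun card_bool card_ord.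
have orth_irr c : irreflexive (@orthant_lt R Y c).
  by move=> p; rewrite /orthant_lt ltxx.
have orth_trans c : transitive (@orthant_lt R Y c).
  move=> q p s /andP[pq0 /forallP pq] /andP[qs0 /forallP qs].
  rewrite /orthant_lt (lt_trans pq0 qs0); apply/forallP => i.
  by move: (pq i) (qs i); rewrite /dir; case: (c i) => H1 H2;
    [exact: lt_trans H2|exact: lt_trans H1].
have orth_total (p q : Y) : p != q -> exists c, orthant_lt c p q || orthant_lt c q p.
  have neq (x y : Y) i : x != y -> val x ord0 i != val y ord0 i.
    by move=> xy; apply: Ygen; rewrite ?fsvalP ?(inj_eq val_inj).
  have lt_ex (x y : Y) : x != y -> val x ord0 ord0 < val y ord0 ord0 ->
      exists c, orthant_lt c x y.
    move=> xy xy0.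
    exists [ffun i => val x ord0 (lift ord0 i) < val y ord0 (lift ord0 i)].
    rewrite /orthant_lt xy0; apply/forallP => i; rewrite ffunE /dir.
    by have := neq _ _ (lift ord0 i) xy; case: ltgtP.
  move=> pq; have := neq _ _ ord0 pq; rewrite neq_lt => /orP[].
    by move=> /(lt_ex _ _ pq)[c H]; exists c; rewrite H.
  rewrite eq_sym in pq.
  by move=> /(lt_ex _ _ pq)[c H]; exists c; rewrite H orbT.
have hasse c (p q z : Y) : orthant_lt c p z -> orthant_lt c z q -> ~~ box_graph Y p q.
  move=> /andP[pz0 /forallP pz] /andP[zq0 /forallP zq].
  rewrite box_graphE negb_and negbK negbK; apply/orP; right.
  apply/existsP; exists z; apply/forallP => i; rewrite /between.
  case: (unliftP ord0 i) => [j|] ->; last by rewrite pz0 zq0.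
  by move: (pz j) (zq j); rewrite /dir; case: (c j) => -> ->; rewrite ?orbT.
have := hasse_union_arcs orth_irr orth_trans orth_total (@box_graph_sym R Y)
  (@box_graph_irr R Y) hasse [ffun=> true] L_gt0.
rewrite cardC -card_edges; [|exact: box_graph_sym|exact: box_graph_irr].
rewrite cardfE; have -> : half (expn 2 4) = 8%N by [].
rewrite [_.-1]/= [X in (X <= _)%N -> _](_ : _ = 16 * (L * #|edges (box_graph Y)|))%N;
  last by rewrite (mulnCA L) mulnA.
by [].
Qed.

(** * The construction for the lower bound *)

Section EightClusters.
Local Open Scope nat_scope.

(* Row [t] lists [x XOR 2 ^ t]: with x = 4a + 2b + c, this is 4a + 2b + (1 - c),
   4a + 2(1 - b) + c, or 4(1 - a) + 2b + c, so that the first of the bits a, b, c in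
   which two clusters differ determines the orthant. *)
Definition digit (t x : nat) : nat := nth 0 (nth [::] [::
  [:: 1; 0; 3; 2; 5; 4; 7; 6];
  [:: 2; 3; 0; 1; 6; 7; 4; 5];
  [:: 4; 5; 6; 7; 0; 1; 2; 3]] t) x.

(* [s] and [s'] stand for the outcome of the comparison inside a cluster. *)
Lemma digit_not_between (u v w : nat) (s s' : bool) : u < 8 -> v < 8 -> w < 8 -> u != v ->
  ~ forall t : 'I_3,
    (digit t u < digit t w + s) && (digit t w < digit t v + s') ||
    (digit t v < digit t w + ~~ s') && (digit t w < digit t u + ~~ s).
Proof.
move=> u8 v8 w8 uv H.
have: all (fun u => all (fun v => all (fun w => all (fun s : bool => all (fun s' : bool =>
    (u != v) ==> ~~ all (fun t =>
    (digit t u < digit t w + s) && (digit t w < digit t v + s') ||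
    (digit t v < digit t w + ~~ s') && (digit t w < digit t u + ~~ s)) (iota 0 3))
    [:: true; false]) [:: true; false]) (iota 0 8)) (iota 0 8)) (iota 0 8) by vm_compute.
have mem8 x : x < 8 -> x \in iota 0 8 by rewrite mem_iota.
have memb (b : bool) : b \in [:: true; false] by case: b.
move=> /allP/(_ u (mem8 _ u8))/allP/(_ v (mem8 _ v8))/allP/(_ w (mem8 _ w8)).
move=> /allP/(_ s (memb s))/allP/(_ s' (memb s'))/implyP/(_ uv)/negP; apply.
by apply/allP => t; rewrite mem_iota => t3; apply: (H (Ordinal t3)).
Qed.

(* Eight clusters of points, cluster [r] consisting of the [m] with [m %% 8 = r].
   Any two clusters differ in mixed directions, whereas each cluster is
   increasing in all three coordinates. *)
Definition coord (n : nat) (t : 'I_3) (m : nat) := digit t (m %% 8) * n + m.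

(** Indices are below [n], so coordinates are ordered lexicographically, by digit and then by
    index. *)
Lemma coord_lt n t (i k : 'I_n) : coord n t i < coord n t k ->
  digit t (i %% 8) < digit t (k %% 8) + (i < k).
Proof.
have := ltn_ord i; have := ltn_ord k.
rewrite /coord; move: (digit _ _) (digit _ _) => a b k_n i_n.
case: (ltnP i k) => ik; rewrite ?addn1 ?addn0 ?ltnS => H; last by nia.
by rewrite leqNgt; apply/negP => ba; nia.
Qed.

Lemma coord_not_between n (i j k : 'I_n) : i %% 8 != j %% 8 ->
  ~ forall t, (coord n t i < coord n t k) && (coord n t k < coord n t j) ||
              (coord n t j < coord n t k) && (coord n t k < coord n t i).
Proof.
move=> ij H.
(* In the reversed case the tie-breaks are [j < k] and [k < i], which imply the negations of [k < j]
   and [i < k]. *)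
apply: (@digit_not_between (i %% 8) (j %% 8) (k %% 8) (i < k) (k < j)); rewrite ?ltn_pmod //.
have weaken (a : bool) x y : x < y + a -> forall b : bool, (a ==> b) -> x < y + b.
  by case: a => //= + [] //=; rewrite ?addn0 ?addn1 // => /ltnW.
move=> t; case/orP: (H t) => /andP[/coord_lt h1 /coord_lt h2]; apply/orP; [left|right].
  by rewrite h1 ?h2.
apply/andP; split; [move: h1|move: h2]; move=> /weaken; apply; apply/implyP; lia.
Qed.

Lemma arcs_mod8 n :
  7 * n ^ 2 <= 8 * \sum_(i < n) \sum_(j < n) (i %% 8 != j %% 8) + 8 * n.
Proof.
have row (i : 'I_n) : n <= \sum_(j < n) (i %% 8 != j %% 8) + (n %/ 8).+1.
  have -> : \sum_(j < n) (i %% 8 != j %% 8) = #|[set j : 'I_n | i %% 8 != j %% 8]%SET|.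
    by rewrite -sum1dep_card [RHS]big_mkcond.
  rewrite -[leqLHS](card_ord n) -(cardsC [set j : 'I_n | i %% 8 != j %% 8]%SET).
  (* The quotient by 8 is injective on the residue class of [i]. *)
  rewrite leq_add2l; pose h (j : 'I_n) : 'I_(n %/ 8).+1 := inord (j %/ 8).
  rewrite -[leqRHS](card_ord (n %/ 8).+1) -(card_in_imset (f := h)) ?max_card //.
  move=> j k; rewrite !inE !negbK => /eqP ij /eqP ik /(congr1 val).
  rewrite /h /= !inordK ?ltnS ?leq_div2r ?(ltnW (ltn_ord _)) // => jk.
  by apply: val_inj; rewrite /= (divn_eq j 8) (divn_eq k 8) jk -ij -ik.
have : \sum_(i < n) n <= \sum_(i < n) (\sum_(j < n) (i %% 8 != j %% 8) + (n %/ 8).+1).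
  by apply: leq_sum => i _; apply: row.
rewrite big_split /= !sum_nat_const !card_ord -mulnn.
have := leq_trunc_div n 8; move: (\sum_i _) (n %/ 8) => x d; nia.
Qed.

Lemma exists_box_graph_edges (R : realType) (n : nat) : exists Y : {fset 'rV[R]_3},
  [/\ generic Y, #|` Y| = n & 7 * n ^ 2 <= 16 * #|edges (box_graph Y)| + 8 * n].
Proof.
pose pt (m : 'I_n) : 'rV[R]_3 := \row_t ((coord n t m)%:R)%R.
have coord_inj t (i j : 'I_n) : coord n t i = coord n t j -> i = j.
  (* Modulo [n] every coordinate is the index itself. *)
  move=> /(congr1 (modn^~ n)); rewrite /coord !modnMDl !modn_small //; exact: val_inj.
have pt_inj : injective pt.
  move=> i j /rowP/(_ ord0); rewrite !mxE => /eqP; rewrite eqr_nat => /eqP.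
  exact: coord_inj.
pose Y := [fset pt m | m in 'I_n]%fset.
have cardY : #|` Y| = n by rewrite card_imfset //= -cardE card_ord.
exists Y; split=> //.
  move=> p q /imfsetP[i _ ->] /imfsetP[j _ ->] ij t; rewrite !mxE eqr_nat.
  by apply: contra_neq ij => /coord_inj->.
rewrite -[16]/(8 * 2) -(mulnA 8 2) card_edges;
  [|exact: box_graph_sym|exact: box_graph_irr].
apply: leq_trans (arcs_mod8 n) _; rewrite leq_add2r leq_mul2l /=.
have ptY m : pt m \in Y by apply/imfsetP; exists m.
pose h m : Y := [` ptY m].
have h_inj : injective h by move=> i j /(congr1 val) /pt_inj.
have h_bij : bijective h by apply: inj_card_bij => //; rewrite -cardfE cardY card_ord.
rewrite arcsT (reindex h) /=; last exact: onW_bij.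
apply: leq_sum => i _; rewrite [leqRHS](reindex h) /=; last exact: onW_bij.
apply: leq_sum => j _; case: eqP => //= /eqP ij; rewrite lt0b box_graphE.
apply/andP; split; first by apply: contraNneq ij => /h_inj->.
apply/existsPn => z; apply/negP => /forallP izj.
have /imfsetP[k _ zk] := valP z.
apply: (coord_not_between (k := k) ij) => t; have := izj t.
by rewrite zk /between !mxE !ltr_nat.
Qed.
End EightClusters.

(** * Choice of the chain length and the error terms *)

(** With this [L], [L ^ 5 * n <= n ^ 2], so the whole error is of order [n ^ 2 / L], while [L] still
    tends to infinity. *)
Definition root5 (n : nat) : nat := (\max_(k < n.+1 | (k ^ 5 <= n)%N) k)%N.

Lemma root5_exp n : (root5 n ^ 5 <= n)%N.
Proof.
rewrite /root5; apply: (big_ind (fun k => k ^ 5 <= n)%N) => // x y.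
by case: (leqP x y).
Qed.

Lemma leq_root5 k n : (k ^ 5 <= n)%N -> (k <= root5 n)%N.
Proof.
move=> kn; have k_lt : (k < n.+1)%N.
  rewrite ltnS (leq_trans _ kn) //; case: k {kn} => // k.
  by rewrite -[leqLHS]expn1 leq_pexp2l.
exact: (leq_bigmax_cond (Ordinal k_lt)).
Qed.

Theorem theorem4 (R : realType) :
  (exists f : nat -> R,
     f =o_\oo (fun n : nat => n%:R ^+ 2 : R) /\
     forall (n : nat) (Y : {fset 'rV[R]_3}),
       generic Y -> #|` Y| = n ->
       #|edges (box_graph Y)|%:R <= 7 / 16 * n%:R ^+ 2 + f n) /\
  (exists g : nat -> R,
     g =o_\oo (fun n : nat => n%:R ^+ 2 : R) /\
     forall n : nat, exists Y : {fset 'rV[R]_3},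
       [/\ generic Y, #|` Y| = n &
         7 / 16 * n%:R ^+ 2 - g n <= #|edges (box_graph Y)|%:R]).
Proof.
split.
  (* The constant is [8 * (2 + 4) / 16 = 3]. *)
  exists (fun n => 3 * n%:R ^+ 2 / (root5 n)%:R); split.
    apply/eqoP => eps eps0.
    exists ((Num.truncn (3 / eps)).+1 ^ 5)%N => // n /leq_root5 rootn.
    rewrite !ger0_norm ?divr_ge0 ?mulr_ge0 ?sqr_ge0 //.
    have root_gt : 3 / eps < (root5 n)%:R.
      by apply: lt_le_trans (truncnS_gt _) _; rewrite ler_nat.
    have root_gt0 : 0 < (root5 n)%:R :> R.
      by apply: le_lt_trans root_gt; rewrite divr_ge0 // ltW.
    rewrite ler_pdivrMr // mulrAC ler_wpM2r ?sqr_ge0 //.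
    by rewrite mulrC -ler_pdivrMr // ltW.
  move=> n Y Ygen cardY.
  (* For [n = 0] the root is 0 and cannot serve as [L]; there are no edges then. *)
  have [n0|n_gt0] := posnP n.
    suff -> : #|edges (box_graph Y)| = 0%N.
      by rewrite addr_ge0 ?divr_ge0 ?mulr_ge0 ?sqr_ge0.
    apply/eqP; rewrite cards_eq0 -finset.subset0; apply/fintype.subsetP => E.
    case/imsetP => [[p q] _ _].
    have Y0 := cardfs0_eq (etrans cardY n0).
    by have : fsval p \in fset0 by rewrite -[X in _ \in X]Y0; apply: fsvalP.
  have L_gt0 : (0 < root5 n)%N by apply: leq_root5.
  have := edges_box_graph_le Ygen L_gt0; rewrite cardY.
  move: (root5_exp n) L_gt0; move: (root5 n) #|edges _| => L E L5 L_gt0 EL.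
  have {}EL : (16 * (L * E) <= 7 * (L * n ^ 2) + 48 * n ^ 2)%N.
    have : (L ^ 5 * n <= n ^ 2)%N by rewrite -mulnn leq_mul2r L5 orbT.
    lia.
  move: EL; rewrite -(ler_nat R) !(natrD, natrM, natrX) => EL.
  have L0 : 0 < L%:R :> R by rewrite ltr0n.
  rewrite -(ler_pM2l L0) mulrDr [X in _ + X]mulrC divfK ?lt0r_neq0 //.
  lra.
(* The construction loses only [n / 2] edges. *)
exists (fun n => n%:R); split.
  apply/eqoP => eps eps0.
  exists (Num.truncn (eps^-1)).+1 => // n /= nbig.
  rewrite !ger0_norm ?sqr_ge0 //.
  have n_gt : eps^-1 < n%:R by apply: lt_le_trans (truncnS_gt _) _; rewrite ler_nat.
  rewrite expr2 mulrA ler_peMl // -ler_pdivrMl // mulr1; exact: ltW.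
move=> n; have [Y [Ygen cardY]] := exists_box_graph_edges R n.
rewrite -(ler_nat R) !(natrD, natrM, natrX) => EY.
exists Y; split=> //; have n0 : 0 <= n%:R :> R by [].
lra.
Qed.
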